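(* Let $x\in\mathbb{R}^3$, let $X$ be a real symmetric $3\times 3$ matrix and let $z\in\mathbb{R}$. Suppose that $(x,X,z)$ satisfies the linear constraints $$z\ge 0,\quad z\le X_{12},\quad z\le X_{13},\quad z\le X_{23},$$ $$X_{12}+X_{13}\le x_1+z,\quad X_{12}+X_{23}\le x_2+z,\quad X_{13}+X_{23}\le x_3+z,$$ $$x_1+x_2+x_3+z\le X_{12}+X_{13}+X_{23}+1,$$ together with all rotated second-order cone constraints obtained from $$(X_{12}+z)^2\le X_{11}(X_{22}+3X_{23})$$ by permuting the indices $1,2,3$ and switching variables. Then $(x,X)$ satisfies all of the ETRI3 constraints.
   Context: Rotated second-order cone constraints: a constraint $u^2\le vw$ of this kind is understood to include $v\ge 0$ and $w\ge 0$. Permuting indices replaces $(1,2,3)$ by a permutation $(i,j,k)$ of $(1,2,3)$ (with $X_{ij}=X_{ji}$ and $z$ unchanged), giving $(X_{ij}+z)^2\le X_{ii}(X_{jj}+3X_{jk})$. Switching the variables in a set $S\subseteq\{1,2,3\}$ in a constraint in $(x,X,z)$ means making simultaneously the following substitutions: $x_p\mapsto 1-x_p$ for $p\in S$ and $x_p\mapsto x_p$ for $p\notin S$; $X_{pp}\mapsto 1-2x_p+X_{pp}$ for $p\in S$ and $X_{pp}\mapsto X_{pp}$ for $p\notin S$; for $p\ne q$: $X_{pq}\mapsto X_{pq}$ if $p,q\notin S$, $X_{pq}\mapsto x_q-X_{pq}$ if $p\in S$, $q\notin S$, and $X_{pq}\mapsto X_{pq}+1-x_p-x_q$ if $p,q\in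 S$; and $z\mapsto z$ if $S=\emptyset$, $z\mapsto X_{qr}-z$ if $S=\{p\}$ with $\{p,q,r\}=\{1,2,3\}$, $z\mapsto x_r-X_{pr}-X_{qr}+z$ if $S=\{p,q\}$ with $\{p,q,r\}=\{1,2,3\}$, and $z\mapsto 1-x_1-x_2-x_3+X_{12}+X_{13}+X_{23}-z$ if $S=\{1,2,3\}$. (The variable $z$ is a proxy for $x_1x_2x_3$.) The switchings of a constraint are all constraints obtained from it in this way for subsets $S\subseteq\{1,2,3\}$. The ETRI3 constraints are the 48 inequalities consisting of $4x_1 + 4X_{11} - 8X_{12} - 4X_{13} + X_{22} + 3X_{23} \ge 0$, $4x_1 + 4X_{11} - 4X_{12} - 8X_{13} + 3X_{23} + X_{33} \ge 0$, $4x_2 + X_{11} - 8X_{12} + 3X_{13} + 4X_{22} - 4X_{23} \ge 0$, $4x_2 - 4X_{12} + 3X_{13} + 4X_{22} - 8X_{23} + X_{33} \ge 0$, $4x_3 + X_{11} + 3X_{12} - 8X_{13} - 4X_{23} + 4X_{33} \ge 0$, $4x_3 + 3X_{12} - 4X_{13} + X_{22} - 8X_{23} + 4X_{33} \ge 0$ and their switchings. *)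

(* Defs.v *)
From mathcomp Require Import all_boot all_order all_algebra all_fingroup.
From mathcomp Require Import reals.

Set Implicit Arguments.
Unset Strict Implicit.
Unset Printing Implicit Defensive.
Import Order.TTheory GRing.Theory Num.Theory.
Local Open Scope ring_scope.

(* The indices 1, 2, 3 are the ordinals of value 0, 1, 2. *)
Definition i1 : 'I_3 := @Ordinal 3 0 isT.
Definition i2 : 'I_3 := @Ordinal 3 1 isT.
Definition i3 : 'I_3 := @Ordinal 3 2 isT.

Section Constraints.
Variable R : realType.
Implicit Types (x : 'cV[R]_3) (X : 'M[R]_3) (z u v w : R) (S : {set 'I_3}).

Definition rotated_soc u v w : Prop := [/\ u ^+ 2 <= v * w, 0 <= v & 0 <= w].

(* The constraint (X_ij + z)^2 <= X_ii (X_jj + 3 X_jk), where (i, j, k) is the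
   image of (1, 2, 3) under s. *)
Definition soc_constraint (s : {perm 'I_3}) X z : Prop :=
  let i := s i1 in let j := s i2 in let k := s i3 in
  rotated_soc (X i j + z) (X i i) (X j j + 3 * X j k).

(* The switching of a constraint C in (x, X, z) with respect to S is C
   evaluated at (switch_x S x, switch_X S x X, switch_z S x X z). *)
Definition switch_x S x : 'cV[R]_3 :=
  \col_p (if p \in S then 1 - x p 0 else x p 0).

(* The entry for p \notin S, q \in S is the one for p \in S, q \notin S
   transported by the symmetry of X. *)
Definition switch_X S x X : 'M[R]_3 :=
  \matrix_(p, q)
    if p == q then (if p \in S then 1 - 2 * x p 0 + X p p else X p p)
    else match p \in S, q \in S with
         | false, false => X p q
         | true, false => x q 0 - X p q
         | false, true => x p 0 - X p q
         | true, true => X p q + 1 - x p 0 - x q 0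
         end.

Definition switch_z S x X z : R :=
  match i1 \in S, i2 \in S, i3 \in S with
  | false, false, false => z
  | true, false, false => X i2 i3 - z
  | false, true, false => X i1 i3 - z
  | false, false, true => X i1 i2 - z
  | true, true, false => x i3 0 - X i1 i3 - X i2 i3 + z
  | true, false, true => x i2 0 - X i1 i2 - X i3 i2 + z
  | false, true, true => x i1 0 - X i2 i1 - X i3 i1 + z
  | true, true, true =>
      1 - x i1 0 - x i2 0 - x i3 0 + X i1 i2 + X i1 i3 + X i2 i3 - z
  end.

Definition ETRI3_unswitched x X : Prop :=
  let x1 := x i1 0 in let x2 := x i2 0 in let x3 := x i3 0 in
  let X11 := X i1 i1 in let X22 := X i2 i2 in let X33 := X i3 i3 in
  let X12 := X i1 i2 in let X13 := X i1 i3 in let X23 := X i2 i3 in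
     4 * x1 + 4 * X11 - 8 * X12 - 4 * X13 + X22 + 3 * X23 >= 0
  /\ 4 * x1 + 4 * X11 - 4 * X12 - 8 * X13 + 3 * X23 + X33 >= 0
  /\ 4 * x2 + X11 - 8 * X12 + 3 * X13 + 4 * X22 - 4 * X23 >= 0
  /\ 4 * x2 - 4 * X12 + 3 * X13 + 4 * X22 - 8 * X23 + X33 >= 0
  /\ 4 * x3 + X11 + 3 * X12 - 8 * X13 - 4 * X23 + 4 * X33 >= 0
  /\ 4 * x3 + 3 * X12 - 4 * X13 + X22 - 8 * X23 + 4 * X33 >= 0.

Definition ETRI3 x X : Prop :=
  forall S, ETRI3_unswitched (switch_x S x) (switch_X S x X).

End Constraints.

(* Main.v *)
Require Import Defs.
From mathcomp Require Import all_boot all_order all_algebra all_fingroup.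
From mathcomp Require Import reals.
From mathcomp Require Import lra.

Set Implicit Arguments.
Unset Strict Implicit.
Unset Printing Implicit Defensive.
Import Order.TTheory GRing.Theory Num.Theory.
Local Open Scope ring_scope.

(** The two factors on the right of a rotated cone constraint enter an
    inequality of arithmetic and geometric means: since
    [4 * X_ii * (X_jj + 3 * X_jk)] is at least [(2 * (X_ij + z)) ^ 2],
    [[
      4 * X_ii + X_jj + 3 * X_jk >= 4 * (X_ij + z).
    ]]
    Four times the triangle inequality [X_ij + X_ik <= x_i + z], added to
    this, eliminates [z] and gives
    [[
      4 * x_i + 4 * X_ii - 8 * X_ij - 4 * X_ik + X_jj + 3 * X_jk >= 0,
    ]]
    whose instances at the six permutations [(i, j, k)] of the indices are the
    six unswitched ETRI3 inequalities ([ETRI3_unswitchedP]).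

    It remains to see that the hypotheses survive switching.  The cone
    constraints are assumed together with their switchings.  The eight linear
    constraints say that the linearizations of the eight products
    [y_1 * y_2 * y_3], where each [y_p] is [x_p] or [1 - x_p], are nonnegative;
    switching [S] exchanges [x_p] and [1 - x_p] for [p] in [S], and so permutes
    these products.  Hence each switched triangle inequality is again one of
    the eight constraints ([triangles_switch]). *)

Section Etri3.
Variable R : realType.
Implicit Types (x : 'cV[R]_3) (X : 'M[R]_3) (z u v w : R) (S : {set 'I_3}).

(** This is [2 * sqrt (v' * w) <= v' + w] at [v' = 4 * v]; the factor 4 is the
    ratio of the coefficients of [X_ii] and [X_jj] in the ETRI3 inequalities. *)
Lemma rotated_soc_amgm u v w : rotated_soc u v w -> 4 * u <= 4 * v + w.
Proof.
case=> u2_le v_ge0 w_ge0.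
have s_ge0 : 0 <= 4 * v + w by lra.
have [u_le0|u_gt0] := lerP u 0; first by lra.
rewrite -ler_sqr ?nnegrE //; last by lra.
(* The gap is [16 * (v * w - u ^+ 2) + (4 * v - w) ^+ 2]. *)
have := sqr_ge0 (4 * v - w); nra.
Qed.

Lemma perm_of_triple (i j k : 'I_3) :
  uniq [:: i; j; k] -> exists s : {perm 'I_3}, [/\ s i1 = i, s i2 = j & s i3 = k].
Proof.
move=> /(tuple_uniqP [tuple i; j; k]) inj_t.
by exists (perm inj_t); rewrite !permE.
Qed.

(** Each inequality is the nonnegativity of the linearization
    [x_i - X_ij - X_ik + z] of [x_i * (1 - x_j) * (1 - x_k)]. *)
Definition triangles x X z : Prop :=
  [/\ X i1 i2 + X i1 i3 <= x i1 0 + z,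
      X i1 i2 + X i2 i3 <= x i2 0 + z
    & X i1 i3 + X i2 i3 <= x i3 0 + z].

Lemma ETRI3_unswitchedP x X z :
  X^T = X -> triangles x X z -> (forall s, soc_constraint s X z) ->
  ETRI3_unswitched x X.
Proof.
move=> X_sym [tri1 tri2 tri3] soc.
have symE p q : X p q = X q p by rewrite -[in LHS]X_sym mxE.
have amgm i j k : uniq [:: i; j; k] ->
    4 * (X i j + z) <= 4 * X i i + (X j j + 3 * X j k).
  move=> /perm_of_triple[s [si sj sk]]; apply: rotated_soc_amgm.
  by have := soc s; rewrite /soc_constraint si sj sk.
have a123 := amgm i1 i2 i3 isT; have a132 := amgm i1 i3 i2 isT.
have a213 := amgm i2 i1 i3 isT; have a231 := amgm i2 i3 i1 isT.
have a312 := amgm i3 i1 i2 isT; have a321 := amgm i3 i2 i1 isT.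
move: a123 a132 a213 a231 a312 a321.
rewrite (symE i2 i1) (symE i3 i1) (symE i3 i2) => *.
by do ![split]; lra.
Qed.

Lemma switch_X_sym S x X : X^T = X -> (switch_X S x X)^T = switch_X S x X.
Proof.
move=> X_sym; apply/matrixP=> p q; rewrite !mxE eq_sym.
have symE : X q p = X p q by rewrite -[in LHS]X_sym mxE.
case: eqP => [-> //|_]; rewrite symE.
by case: (p \in S) (q \in S) => [] []; lra.
Qed.

(** The hypotheses are the whole orbit under switching: for a fixed triangle
    inequality, the eight sets [S] give the eight linear constraints, each
    once. *)
Lemma triangles_switch S x X z :
  X^T = X -> 0 <= z -> z <= X i1 i2 -> z <= X i1 i3 -> z <= X i2 i3 ->
  triangles x X z ->
  x i1 0 + x i2 0 + x i3 0 + z <= X i1 i2 + X i1 i3 + X i2 i3 + 1 ->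
  triangles (switch_x S x) (switch_X S x X) (switch_z S x X z).
Proof.
move=> X_sym z0 z12 z13 z23 [tri1 tri2 tri3] tri123.
have symE p q : X p q = X q p by rewrite -[in LHS]X_sym mxE.
rewrite /triangles /switch_z !mxE /= (symE i2 i1) (symE i3 i1) (symE i3 i2).
by case: (i1 \in S) (i2 \in S) (i3 \in S) => [] [] []; split; lra.
Qed.

End Etri3.

Theorem lemma5 (R : realType) (x : 'cV[R]_3) (X : 'M[R]_3) (z : R)
  (X_sym : X^T = X)
  (z_ge0 : 0 <= z)
  (z_le12 : z <= X i1 i2)
  (z_le13 : z <= X i1 i3)
  (z_le23 : z <= X i2 i3)
  (tri1 : X i1 i2 + X i1 i3 <= x i1 0 + z)
  (tri2 : X i1 i2 + X i2 i3 <= x i2 0 + z)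
  (tri3 : X i1 i3 + X i2 i3 <= x i3 0 + z)
  (tri123 : x i1 0 + x i2 0 + x i3 0 + z
              <= X i1 i2 + X i1 i3 + X i2 i3 + 1)
  (soc : forall (s : {perm 'I_3}) (S : {set 'I_3}),
     soc_constraint s (switch_X S x X) (switch_z S x X z)) :
  ETRI3 x X.
Proof.
move=> S; apply: (@ETRI3_unswitchedP _ _ _ (switch_z S x X z)).
- exact: switch_X_sym.
- exact: triangles_switch.
- by move=> s; apply: soc.
Qed.
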